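(* Let $G\le\mathrm{Sym}(\Omega)$ be a Frobenius group with Frobenius kernel $K$ and Frobenius complement $H$. If $L$ is a minimal $(G,\Omega)$-Cameron-Liebler set, i.e. a nonempty CL set containing no nonempty CL set as a proper subset, then there is a function $f:H\to K$ such that $L=\{f(h)h: h\in H\}$.
   Context: A Frobenius group is a finite transitive permutation group $G\le \mathrm{Sym}(\Omega)$ in which no non-identity element fixes more than one point and some non-identity element fixes a point. The Frobenius complement is $H=G_\omega$, the stabilizer of a point $\omega$; the Frobenius kernel is $K=\left(G\setminus\bigcup_{g\in G}gHg^{-1}\right)\cup\{e\}$, a normal subgroup acting regularly on $\Omega$. For $a,b\in\Omega$ the star is $G_{a\to b}=\{g\in G:g(a)=b\}$ with indicator vector $\mathbf{v}_{a,b}$. A $(G,\Omega)$-Cameron-Liebler (CL) set is a subset of $G$ whose indicator vector is a linear combination of the $\mathbf{v}_{a,b}$. *)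

(* Defs.v *)
From HB Require Import structures.
From mathcomp Require Import all_boot all_order all_algebra.
From mathcomp Require Import all_fingroup all_solvable.

Set Implicit Arguments.
Unset Strict Implicit.
Unset Printing Implicit Defensive.

Import GRing.Theory Num.Theory.

Local Open Scope group_scope.

(* Permutations are multiplied left to right: (x * y) t = y (x t).  So the    *)
(* composite "x after y" is the product y * x, and the conjugate of H written *)
(* g H g^-1 in terms of composition is H :^ g = g^-1 * H * g.                 *)

(* [Frobenius_action G H [set: T] 'P] says that G is a Frobenius permutation  *)
(* group on T and that H is a point stabilizer; here it is compared with the  *)
(* textbook wording.                                                          *)
Lemma Frobenius_action_permP (T : finType) (G : {group {perm T}}) (w : T) :
  Frobenius_action G 'C_G[w | 'P] [set: T] 'P <->
  [/\ [transitive G, on [set: T] | 'P],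
      forall g, g \in G -> g != 1 -> forall a b, g a = a -> g b = b -> a = b
    & exists g, [/\ g \in G, g != 1 & exists a, g a = a] ].
Proof.
split=> [[_ trG fix1 ntH _]|[trG fix1 [g [Gg ntg [a ga]]]]].
  split=> // [g Gg ntg a b ga gb|].
    have/card_le1_eqP: #|'Fix_([set: T] | 'P)[g]| <= 1.
      by apply: fix1; rewrite !inE ntg.
    by apply; apply/setIP; rewrite inE; split=> //; apply/afix1P.
  have /trivgPn[h /setIP[Gh /astab1P hw] nth] := ntH.
  by exists h; split=> //; exists w.
split=> //.
- apply/subsetP=> x /setIP[_ /astabP fixx]; apply/set1gP/permP=> t.
  by rewrite perm1; apply: (fixx t); rewrite inE.
- move=> x; rewrite !inE => /andP[ntx Gx]; apply/card_le1_eqP=> s t.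
  move=> /setIP[_ /afix1P xs] /setIP[_ /afix1P xt]; exact: (fix1 x).
- have [y Gy ya] := atransP2 trG (in_setT a) (in_setT w).
  apply/trivgPn; exists (g ^ y).
    rewrite inE groupJ //; apply/astab1P.
    by rewrite ya /= !apermE permJ ga.
  by rewrite conjg_eq1.
- by exists w; rewrite ?inE.
Qed.

(* A set, not a {group _}: that it is a subgroup is Frobenius' theorem.       *)
Definition Frobenius_kernel_set (gT : finGroupType) (G H : {set gT}) :
  {set gT} := 1 |: (G :\: \bigcup_(g in G) H :^ g).

Section CameronLiebler.

Variables (F : numFieldType) (T : finType).
Implicit Types G L M : {set {perm T}}.

Definition star G (a b : T) : {set {perm T}} := [set g in G | g a == b].

(* Vectors are indexed by Sym(T) rather than G; those of subsets of G vanish  *)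
(* off G.                                                                     *)
Definition indicator L : {ffun {perm T} -> F^o} :=
  [ffun g => (g \in L)%:R%R].

Definition CL_set G L : Prop :=
  L \subset G /\
  exists c : T -> T -> F,
    indicator L = (\sum_a \sum_b c a b *: indicator (star G a b))%R.

Definition minimal_CL_set G L : Prop :=
  [/\ CL_set G L, L != set0
    & forall M, CL_set G M -> M != set0 -> ~~ (M \proper L)].

End CameronLiebler.

(* Main.v *)
Require Import Defs.
From mathcomp Require Import all_boot all_order all_algebra.
From mathcomp Require Import all_fingroup all_solvable.
From mathcomp Require Import vcharacter.

(** Write [n] for the degree.  The kernel [K] is regular, so every star meets
    every coset [x *: K] in exactly one element; hence a linear combination of
    stars has the same sum over all these cosets, and a CL set [L] meets all of
    them in the same number of elements.

    Conversely let [M] meet every coset [x *: K] exactly once.  For [x], [g] in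
    [G], the permutations [x] and [g] agree in [n] points if [x = g], in no
    point if [x] and [g] are distinct in the same coset, and in exactly one
    point otherwise.  So the sum over [g] in [M], [a] in [T] of the star
    [G_(a -> g a)] is [n 1_M + (|M| - 1) 1_G], and [M] is a CL set.

    A nonempty CL set therefore contains such an [M], and equals it when
    minimal. *)

Set Implicit Arguments.
Unset Strict Implicit.
Unset Printing Implicit Defensive.

Import GRing.Theory Num.Theory.

Local Open Scope group_scope.

(** [K] and the conjugates of [H] without identity partition [G]. An element of [K] in a conjugate
    of [H] is conjugate to one of [K :&: H], which is trivial. *)
Lemma Frobenius_kernel_setE (gT : finGroupType) (G H K : {group gT}) :
  [Frobenius G = K ><| H] -> Frobenius_kernel_set G H = K.
Proof.
move=> frobG; have [defG _ _ _ _] := Frobenius_context frobG.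
have [/andP[sKG nKG] sHG _ _ tiKH] := sdprod_context defG.
apply/setP=> g; rewrite !inE; have [-> | ntg] /= := eqVneq.
  by rewrite group1.
apply/andP/idP=> [[notHg Gg] | Kg].
  have /and3P[/eqP covG _ _] := Frobenius_partition frobG.
  move: (Gg); rewrite -covG => /bigcupP[A /setU1P[-> // | /imsetP[x Kx ->]]].
  rewrite conjD1g => /setD1P[_ Hxg]; case/negP: notHg.
  by apply/bigcupP; exists x => //; apply: (subsetP sKG).
split; last exact: (subsetP sKG).
apply: contra ntg => /bigcupP[x Gx Hxg].
rewrite -(conjg_eq1 g x^-1) -in_set1 -set1gE -tiKH inE.
apply/andP; split; last by rewrite -mem_conjg.
by rewrite memJ_norm // groupV (subsetP nKG).
Qed.

Section FrobeniusPermutations.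

Variables (T : finType) (G H K : {group {perm T}}).
Hypothesis actG : Frobenius_action G H [set: T] 'P.
Hypothesis frobG : [Frobenius G = K ><| H].

(** By transitivity, the conjugates of the point stabilizer [H] are the stabilizers of all the
    points. *)
Lemma mem_conjugates_stabilizer g :
  (g \in \bigcup_(x in G) H :^ x) = (g \in G) && [exists a, g a == a].
Proof.
have [_ trG _ _ [w _ defH]] := actG.
apply/bigcupP/andP=> [[x Gx]|[Gg /existsP[a /eqP ga]]].
  rewrite defH conjIg conjGid // => /setIP[Gg].
  rewrite -astab1_act => /astab1P /= gxw; split=> //.
  by apply/existsP; exists (x w); apply/eqP.
have [x Gx ax] := atransP2 trG (in_setT w) (in_setT a).
exists x => //; rewrite defH conjIg conjGid // inE Gg -astab1_act.
by apply/astab1P; rewrite -ax.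
Qed.

Lemma card_fixpoints g : g \in G -> g != 1 ->
  #|[set a | g a == a]| = (g \notin K).
Proof.
move=> Gg ntg; have [_ _ fix1 _ _] := actG.
rewrite -(Frobenius_kernel_setE frobG) !inE (negPf ntg) Gg andbT negbK.
rewrite mem_conjugates_stabilizer Gg /=.
have: #|[set a | g a == a]| <= 1.
  have <- : 'Fix_([set: T] | 'P)[g] = [set a | g a == a].
    by apply/setP=> a; rewrite !inE sub1set inE.
  by apply: fix1; rewrite !inE ntg.
case: existsP => [[a ga]|no_fix].
  suffices: 0 < #|[set a | g a == a]| by case: #|_| => [|[]].
  by apply/card_gt0P; exists a; rewrite inE.
move=> _; apply: eq_card0 => a; rewrite inE.
by apply/negP=> ga; case: no_fix; exists a.
Qed.

(** [x] and [g] agree at [a] exactly when [x^-1 * g] fixes [x a], so the count is one of fixed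
    points. *)
Lemma card_agree x g : x \in G -> g \in G ->
  #|[set a | x a == g a]| = if x == g then #|T| else g \notin x *: K.
Proof.
move=> Gx Gg; have [-> | neq_xg] := eqVneq x g.
  by rewrite -cardsT; congr #|pred_of_set _|; apply/setP=> a; rewrite !inE eqxx.
rewrite mem_lcoset -card_fixpoints ?groupM ?groupV //; last first.
  by rewrite -eq_mulVg1.
rewrite -[RHS](card_preimset _ (@perm_inj _ x)); congr #|pred_of_set _|.
by apply/setP=> a; rewrite !inE permM permK eq_sym.
Qed.

Lemma kernel_trans : [transitive K, on [set: T] | 'P].
Proof.
have [_ trG _ _ [w _ defH]] := actG.
have [/eqP defG _] := andP frobG; have [sKG _ _ _ _] := sdprod_context defG.
apply/(subgroup_transitiveP (in_setT w) (normal_sub sKG) trG).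
by rewrite -defH (sdprodWC defG).
Qed.

(** Transitivity of [K] gives an element; distinct elements of one coset agree nowhere, so there is
    no other. *)
Lemma card_star_coset x a b : x \in G -> #|star G a b :&: x *: K| = 1%N.
Proof.
move=> Gx; have [/eqP defG _] := andP frobG.
have [/andP[sKG _] _ _ _ _] := sdprod_context defG.
have [k Kk kxa] := atransP2 kernel_trans (in_setT (x a)) (in_setT b).
apply/eqP/cards1P; exists (x * k); apply/setP=> y.
rewrite !inE mem_lcoset; apply/andP/eqP=> [|->]; last first.
  by rewrite permM kxa eqxx andbT mulKg groupM // (subsetP sKG).
case=> /andP[Gy /eqP ya] Kxy.
apply/eqP; apply: contraTT Kxy => neq_y.
have := card_agree (groupM Gx (subsetP sKG k Kk)) Gy.
rewrite eq_sym (negPf neq_y) mem_lcoset invMg -mulgA.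
rewrite groupMl ?groupV // => agree.
have: 0 < #|[set c | (x * k) c == y c]|.
  by apply/card_gt0P; exists a; rewrite inE ya permM kxa.
by rewrite agree; case: (_ \in K).
Qed.

End FrobeniusPermutations.

(** For each [a], the only star from [a] containing [g] is the one with [b = g a]. *)
Lemma sum_starE (F : numFieldType) (T : finType) (G : {set {perm T}})
    (c : T -> T -> F) g :
  (\sum_a \sum_b c a b *: indicator F (star G a b))%R g =
  (\sum_a (g \in G)%:R * c a (g a))%R.
Proof.
rewrite sum_ffunE; apply: eq_bigr => a _; rewrite sum_ffunE (bigD1 (g a)) //=.
rewrite big1 ?addr0 => [|b neq_b]; last first.
  by rewrite !ffunE inE eq_sym (negPf neq_b) andbF scaler0.
by rewrite !ffunE inE eqxx andbT mulrC.
Qed.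

Lemma CL_set_card_coset (F : numFieldType) (T : finType)
    (G H K : {group {perm T}}) L :
  Frobenius_action G H [set: T] 'P -> [Frobenius G = K ><| H] ->
  CL_set F G L ->
  {in G &, forall x y, #|L :&: x *: K| = #|L :&: y *: K|}.
Proof.
move=> actG frobG [_ [c defL]].
(* The common value is the sum of all coefficients; [F] has characteristic zero, so cardinals may be
   compared in it. *)
suffices cardL x : x \in G ->
    (#|L :&: (x *: K)%g|%:R = \sum_a \sum_b c a b :> F)%R.
  by move=> x y Gx Gy; apply/eqP; rewrite -(eqr_nat F) !cardL.
move=> Gx.
have cardE A :
    (#|A :&: (x *: K)%g|%:R = \sum_(g in (x *: K)%g) indicator F A g)%R.
  under eq_bigr do rewrite ffunE.
  rewrite -natr_sum -big_mkcondr sum1_card; congr _%:R%R.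
  by apply: eq_card => g; rewrite !inE andbC.
rewrite cardE defL; under eq_bigr do rewrite sum_ffunE.
rewrite exchange_big; apply: eq_bigr => a _.
under eq_bigr do rewrite sum_ffunE.
rewrite exchange_big; apply: eq_bigr => b _.
transitivity (c a b * \sum_(g in (x *: K)%g) indicator F (star G a b) g)%R.
  by rewrite big_distrr; apply: eq_bigr => g _; rewrite ffunE.
by rewrite -cardE (card_star_coset actG frobG) // mulr1.
Qed.

Lemma transversal_CL_set (F : numFieldType) (T : finType)
    (G H K : {group {perm T}}) (M : {set {perm T}}) :
  Frobenius_action G H [set: T] 'P -> [Frobenius G = K ><| H] ->
  M \subset G -> {in G, forall x, #|M :&: x *: K| = 1%N} -> CL_set F G M.
Proof.
move=> actG frobG sMG cardM; split=> //.
have n_gt0 : 0 < #|T|.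
  by have [_ _ _ _ [w _ _]] := actG; apply/card_gt0P; exists w.
have n_neq0 : (#|T|%:R != 0 :> F)%R by rewrite pnatr_eq0 -lt0n.
pose n : F := (#|T|%:R)%R; pose m : F := ((#|M|.-1)%:R)%R.
(* Each element of [G] lies in [n] stars, so all stars with weight [m / n] sum to [m] times the
   indicator of [G]. Subtracting this from the sum of the stars through [M] leaves [n] times the
   indicator of [M]. *)
exists (fun a b => (#|[set g in M | g a == b]|%:R - m / n) / n)%R.
apply/ffunP => x; rewrite sum_starE -big_distrr -big_distrl /= ffunE.
case Gx: (x \in G); last first.
  rewrite mul0r; suffices /negbTE-> : x \notin M by [].
  by apply: contraFN Gx => /(subsetP sMG).
have sum_m : (\sum_(a : T) m / n = m)%R.
  by rewrite sumr_const -[LHS]mulr_natr divfK.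
rewrite mul1r sumrB sum_m -natr_sum.
have /cards1P[g0 defg0]: #|M :&: x *: K| == 1%N by rewrite cardM.
have /setIP[Mg0 Kg0]: g0 \in M :&: x *: K by rewrite defg0 set11.
have count: \sum_a #|[set g in M | g a == x a]| = (x \in M) * #|T| + #|M|.-1.
  have -> : \sum_a #|[set g in M | g a == x a]| =
            \sum_(g in M) #|[set a | x a == g a]|.
    under eq_bigr do rewrite -sum1dep_card big_mkcondr /=.
    rewrite exchange_big; apply: eq_bigr => g _.
    rewrite -sum1dep_card [RHS]big_mkcond; apply: eq_bigr => a _.
    by rewrite eq_sym.
  (* [g0], the element of [M] in the coset of [x], contributes [#|T|] if it is [x] and 0 otherwise;
     every other element of [M] contributes 1. *)
  rewrite (bigD1 g0) //=; congr (_ + _).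
    rewrite (card_agree actG frobG Gx) ?(subsetP sMG) //.
    have [-> | neq_x] := eqVneq x g0; first by rewrite Mg0 mul1n.
    rewrite Kg0.
    case Mx: (x \in M) => //; case/eqP: neq_x; apply/set1P.
    by rewrite -defg0 inE Mx lcoset_refl.
  have -> : #|M|.-1 = #|M :\ g0| by rewrite [#|M|](cardsD1 g0) Mg0.
  rewrite -sum1_card; apply: eq_big => g.
    by rewrite !inE andbC.
  move=> /andP[Mg neq_g]; rewrite (card_agree actG frobG Gx) ?(subsetP sMG) //.
  have notKg: g \notin x *: K.
    apply: contra neq_g => Kg; apply/eqP/set1P.
    by rewrite -defg0 inE Mg.
  case: eqP notKg => [-> | _ ->//]; first by rewrite lcoset_refl.
by rewrite count natrD addrK natrM mulfK.
Qed.

(** Products run left to right, so [h * f h] is the composite written $f(h)h$. *)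
Theorem theorem3p2 (F : numFieldType) (T : finType) (G : {group {perm T}})
    (H K : {set {perm T}}) (L : {set {perm T}}) :
  Frobenius_action G H [set: T] 'P ->
  K = Frobenius_kernel_set G H ->
  minimal_CL_set F G L ->
  exists f : {perm T} -> {perm T},
    (forall h, h \in H -> f h \in K) /\
    L = [set (h * f h)%g | h in H].
Proof.
move=> actG -> [CL_L /set0Pn[y Ly] minL].
have [H1 defH] : exists H1 : {group {perm T}}, H = H1.
  by have [_ _ _ _ [w _ ->]] := actG; exists 'C_G[w | 'P]%G.
rewrite {}defH in actG *.
(* Frobenius' theorem: the kernel is a normal subgroup complementing the stabilizer. *)
have [K1 frobG]: {K1 : {group {perm T}} | [Frobenius G = K1 ><| H1]}.
  apply: Frobenius_kernel_exists.
  by apply/Frobenius_actionP; exists T [set: T] 'P%act.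
have [/eqP defG _] := andP frobG.
have [/andP[sKG _] sHG defHK _ tiKH] := sdprod_context defG.
rewrite (Frobenius_kernel_setE frobG); have [sLG _] := CL_L.
have Lcoset h : h \in H1 -> exists k, (k \in K1) && (h * k \in L).
  move=> Hh; have: 0 < #|L :&: h *: K1|.
    rewrite (CL_set_card_coset actG frobG CL_L _ (subsetP sLG y Ly));
      last exact: (subsetP sHG).
    by apply/card_gt0P; exists y; rewrite inE Ly lcoset_refl.
  case/card_gt0P=> z /setIP[Lz /lcosetP[k Kk defz]].
  by exists k; rewrite Kk -defz.
(* The default 1 is never taken for [h] in [H1], since [L] meets every coset. *)
pose f h := odflt 1 [pick k | (k \in K1) && (h * k \in L)].
have fP h : h \in H1 -> (f h \in K1) && (h * f h \in L).
  move=> Hh; rewrite /f; case: pickP => //= noK.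
  by have [k Lk] := Lcoset h Hh; have /= := noK k; rewrite Lk.
exists f; split=> [h /fP/andP[] // |].
have sML : [set h * f h | h in H1] \subset L.
  by apply/subsetP=> _ /imsetP[h /fP/andP[_ Lhf] ->].
apply/eqP; rewrite eq_sym; move: (minL [set h * f h | h in H1]).
rewrite properEneq sML andbT negbK; apply.
  apply: (transversal_CL_set F actG frobG (subset_trans sML sLG)) => x Gx.
  (* As [G] is the product of [H1] and [K1], the coset is that of some [h] in [H1]; only one [h]
     qualifies because [K1 :&: H1] is trivial. *)
  have [h k Hh Kk ->]: imset2_spec mulg (mem H1) (fun _ => mem K1) x.
    by apply/mulsgP; rewrite (sdprodWC defG).
  apply/eqP/cards1P; exists (h * f h); apply/setP=> z; rewrite !inE.
  have [Kfh _] := andP (fP h Hh).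
  apply/andP/eqP=> [[/imsetP[h' Hh' ->]] | ->]; last first.
    split; first exact: imset_f.
    by rewrite mem_lcoset invMg -mulgA mulKg groupM ?groupV.
  have [Kfh' _] := andP (fP h' Hh').
  rewrite mem_lcoset invMg -mulgA groupMl ?groupV // mulgA groupMr // => Khh'.
  suffices -> : h' = h by [].
  apply/eqP; rewrite eq_sym eq_mulVg1 -in_set1 -set1gE -tiKH inE Khh'.
  by rewrite groupM ?groupV.
by apply/set0Pn; exists (1 * f 1); apply: imset_f.
Qed.
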